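(* Let $G<\mathrm{SU}(4)$ be a finite subgroup such that all its elements have age $\le1$. Then, up to unitary conjugation, $G<\mathrm{SO}(3)<\mathrm{SU}(4)$ or $G<\mathrm{SU}(2)<\mathrm{SU}(4)$.
   Context: For $g\in G$ of order $r$, choose a basis of $\mathbb{C}^4$ in which $g=\mathrm{diag}(\epsilon^{a_1},\epsilon^{a_2},\epsilon^{a_3},\epsilon^{a_4})$ with $\epsilon=\exp(2\pi\sqrt{-1}/r)$ and integers $0\le a_i<r$; then $\mathrm{age}(g):=\frac1r\sum_{i=1}^4a_i$. The embedding $\mathrm{SU}(2)<\mathrm{SU}(4)$ is the one acting trivially on the third and fourth coordinates of $\mathbb{C}^4$; $\mathrm{SU}(3)<\mathrm{SU}(4)$ is the one acting trivially on the fourth coordinate; $\mathrm{SO}(3)<\mathrm{SU}(3)$ is the standard embedding (real orthogonal matrices of determinant one), and $\mathrm{SO}(3)<\mathrm{SU}(4)$ is the composite. *)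

(* Defs.v *)
From HB Require Import structures.
From mathcomp Require Import all_boot all_order all_algebra spectral.
From mathcomp Require Import complex.
From mathcomp Require Import classical_sets cardinality reals trigo.
From mathcomp Require Import lra ring.

Set Implicit Arguments.
Unset Strict Implicit.
Unset Printing Implicit Defensive.

Import Order.TTheory GRing.Theory Num.Theory.

Local Open Scope classical_set_scope.
Local Open Scope complex_scope.
Local Open Scope ring_scope.

Definition SU (R : realType) (n : nat) : set 'M[R[i]]_n :=
  [set A | A \is unitarymx /\ \det A = 1].

Definition SO (R : realType) (n : nat) : set 'M[R]_n :=
  [set A | A *m A^T = 1%:M /\ \det A = 1].

Arguments SU : clear implicits.
Arguments SO : clear implicits.

Definition subgroup_of (R : realType) (n : nat) (G H : set 'M[R[i]]_n) : Prop :=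
  [/\ G `<=` H,
      G 1%:M,
      forall A B, G A -> G B -> G (A *m B)
    & forall A, G A -> G (invmx A)].

Definition SU2_to_SU4 (R : realType) (A : 'M[R[i]]_2) : 'M[R[i]]_4 :=
  block_mx A 0 0 1%:M : 'M_(2 + 2).

Definition SU3_to_SU4 (R : realType) (A : 'M[R[i]]_3) : 'M[R[i]]_4 :=
  block_mx A 0 0 1%:M : 'M_(3 + 1).

Definition SO3_to_SU3 (R : realType) (A : 'M[R]_3) : 'M[R[i]]_3 :=
  map_mx (real_complex R) A.

Definition SU2_in_SU4 (R : realType) : set 'M[R[i]]_4 :=
  @SU2_to_SU4 R @` SU R 2.

Definition SO3_in_SU4 (R : realType) : set 'M[R[i]]_4 :=
  (@SU3_to_SU4 R \o @SO3_to_SU3 R) @` SO R 3.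

Definition unitary_conj (R : realType) (n : nat) (U : 'M[R[i]]_n)
    (G : set 'M[R[i]]_n) : set 'M[R[i]]_n :=
  [set U *m g *m invmx U | g in G].

(* exp (2 pi sqrt(-1) / r), written out by Euler's formula *)
Definition epsilon (R : realType) (r : nat) : R[i] :=
  cos (2 * pi / r%:R) +i* sin (2 * pi / r%:R).

Definition has_order (R : realType) (n : nat) (g : 'M[R[i]]_n) (r : nat) :
    Prop :=
  [/\ (0 < r)%N, g ^+ r = 1%:M
    & forall k : nat, (0 < k < r)%N -> g ^+ k <> 1%:M].

(* The columns of P are the chosen basis. *)
Definition is_age (R : realType) (n : nat) (g : 'M[R[i]]_n) (q : rat) : Prop :=
  exists (r : nat) (P : 'M[R[i]]_n) (a : 'I_n -> nat),
    [/\ has_order g r, P \in unitmx, forall i, (a i < r)%N,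
        invmx P *m g *m P = diag_mx (\row_i epsilon R r ^+ a i)
      & q = (\sum_i a i)%N%:R / r%:R].

Lemma epsilonX (R : realType) (r k : nat) :
  epsilon R r ^+ k = cos (2 * pi / r%:R * k%:R) +i* sin (2 * pi / r%:R * k%:R).
Proof.
elim: k => [|k IH]; first by rewrite mulr0 cos0 sin0 expr0.
have E : 2 * pi / r%:R * k.+1%:R = 2 * pi / r%:R * k%:R + 2 * pi / r%:R :> R.
  by rewrite -[k.+1%:R]natr1 mulrDr mulr1.
rewrite exprSr IH E cosD sinD; apply/eqP; rewrite eq_complex /=.
by rewrite eqxx /= [X in _ == X]addrC.
Qed.

Lemma epsilon_prim (R : realType) (r : nat) :
  (0 < r)%N -> r.-primitive_root (epsilon R r).
Proof.
move=> r0; apply/andP; split=> //; apply/forallP => -[k lkr] /=.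
rewrite unity_rootE epsilonX.
have rn0 : (r%:R : R) != 0 by rewrite pnatr_eq0 -lt0n.
case: (eqVneq k.+1 r) => [->|ne].
  rewrite divfK // -[2 * pi]/(2%:R * pi) mulr_natl cos2pi sin2pi.
  by rewrite eqxx.
have lk : (k.+1 < r)%N by rewrite ltn_neqAle ne.
rewrite eqbF_neg; apply/negP => /eqP[c1 _].
pose x : R := pi * (k.+1%:R / r%:R).
have xE : 2 * pi / r%:R * k.+1%:R = x *+ 2.
  by rewrite -mulr_natl /x; field.
have sx : 0 < sin x.
  apply: sin_gt0_pi; rewrite /x; apply/andP; split.
    by rewrite mulr_gt0 ?pi_gt0 // divr_gt0 ?ltr0n.
  by rewrite gtr_pMr ?pi_gt0 // ltr_pdivrMr ?ltr0n // mul1r ltr_nat.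
have E := cos2Dsin2 x.
move: c1; rewrite xE cos_mulr2n => c1.
have : 0 < sin x ^+ 2 by rewrite exprn_gt0.
by lra.
Qed.

Lemma is_age_inj (R : realType) (n : nat) (g : 'M[R[i]]_n) (q q' : rat) :
  is_age g q -> is_age g q' -> q = q'.
Proof.
move=> [r [P [a [[r0 gr rm] Pu ar gP ->]]]]
  [r' [P' [a' [[r0' gr' rm'] Pu' ar' gP' ->]]]].
have er : r = r'.
  case: (ltngtP r r') => // l.
    by case: (rm' r); rewrite ?r0.
  by case: (rm r'); rewrite ?r0'.
subst r'.
congr (_%:R / _).
have cp : forall (Q : 'M[R[i]]_n) (b : 'I_n -> nat), Q \in unitmx ->
   invmx Q *m g *m Q = diag_mx (\row_i epsilon R r ^+ b i) ->
   char_poly g = \prod_(x <- [seq epsilon R r ^+ b i | i : 'I_n]) ('X - x%:P).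
  move=> Q b Qu E.
  transitivity (char_poly (diag_mx (\row_i epsilon R r ^+ b i))).
    symmetry; rewrite -E /char_poly /char_poly_mx !map_mxM.
    have Qu' : map_mx (@polyC R[i]) Q \in unitmx by rewrite map_unitmx.
    rewrite map_invmx.
    have {1}-> : 'X%:M = invmx (map_mx (@polyC R[i]) Q) *m ('X%:M) *m (map_mx polyC Q).
      by rewrite mul_mx_scalar -scalemxAl mulVmx // scalemx1.
    rewrite -mulmxBl -mulmxBr !det_mulmx mulrAC -det_mulmx mulVmx //.
    by rewrite det1 mul1r.
  rewrite char_poly_trig ?diag_mx_is_trig // big_map big_enum /=.
  by apply: eq_bigr => i _; rewrite !mxE eqxx.
have := cp _ _ Pu gP; rewrite (cp _ _ Pu' gP') => /prod_XsubC_eq.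
rewrite perm_sym => pe.
pose f (x : R[i]) : nat := index x [seq epsilon R r ^+ i | i <- iota 0 r].
have fE k : (k < r)%N -> f (epsilon R r ^+ k) = k.
  move=> kr; rewrite /f -[X in _ ^+ X](_ : nth 0%N (iota 0 r) k = k);
    last by rewrite nth_iota.
  rewrite -(@nth_map _ 0%N _ 0 (fun i => epsilon R r ^+ i)) ?size_iota //.
  rewrite index_uniq ?size_map ?size_iota //.
  rewrite map_inj_in_uniq ?iota_uniq // => i j.
  rewrite !mem_iota /= !add0n => ir jr /eqP.
  by rewrite (eq_prim_root_expr (epsilon_prim R r0)) !modn_small // => /eqP.
have := perm_big _ pe (op := addn) (x := 0%N) (P := xpredT) (F := f).
rewrite !big_image /= => E.
rewrite (eq_bigr (fun i => f (epsilon R r ^+ a i))) => [|i _]; last by rewrite fE.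
by rewrite [LHS]E; apply: eq_bigr => i _; rewrite fE.
Qed.

Lemma is_age_ex (R : realType) (n : nat) (g : 'M[R[i]]_n.+1) (r : nat) :
  has_order g r -> exists q, is_age g q.
Proof.
move=> [r0 gr rm].
have pe := epsilon_prim R r0.
have [|P Pu /diagonalizable_forPex[D /(simmxRL Pu) DE]] :=
   (mxpoly.diagonalizableP g).2.
  exists [seq epsilon R r ^+ i | i <- iota 0 r].
    rewrite map_inj_in_uniq ?iota_uniq // => i j.
    rewrite !mem_iota /= !add0n => ir jr /eqP.
    by rewrite (eq_prim_root_expr pe) !modn_small // => /eqP.
  rewrite big_map -[iota 0 r]/(iota 0 r); have := factor_Xn_sub_1 pe.
  rewrite /index_iota subn0 => ->.
  by apply: mxminpoly_min; rewrite rmorphB rmorphXn rmorph1 /= horner_mx_X gr subrr.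
have Dr i : D 0 i ^+ r = 1.
  have H k : (P *m g *m invmx P) ^+ k = P *m g ^+ k *m invmx P.
    elim: k => [|k IH]; first by rewrite !expr0 mulmx1 mulmxV.
    by rewrite !exprS IH -!mulmxE !mulmxA mulmxKV.
  have HD k : (diag_mx D) ^+ k = diag_mx (\row_j D 0 j ^+ k).
    elim: k => [|k IH].
      by apply/matrixP => x y; rewrite !mxE eq_sym.
    rewrite exprS IH -mulmxE mulmx_diag; congr diag_mx.
    by apply/rowP => j; rewrite !mxE exprS.
  move: (H r); rewrite -DE HD gr mulmx1 mulmxV // => /matrixP/(_ i i).
  by rewrite !mxE eqxx.
pose a i := sval (prim_rootP pe (Dr i)).
exists ((\sum_i (a i : nat))%N%:R / r%:R), r, (invmx P),
  (fun i => a i : nat).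
split=> //; first by rewrite unitmx_inv.
rewrite invmxK -DE; congr diag_mx; apply/rowP => i; rewrite !mxE.
exact: (svalP (prim_rootP pe (Dr i))).
Qed.

(* By [is_age_ex] and [is_age_inj] the age of an element of finite order exists
   and is unique; the default value 0 is only taken in infinite order. *)
Definition age (R : realType) (n : nat) (g : 'M[R[i]]_n) : rat :=
  xget 0 (is_age g).

Lemma ageE (R : realType) (n : nat) (g : 'M[R[i]]_n) (q : rat) :
  is_age g q -> age g = q.
Proof.
move=> gq; rewrite /age; case: xgetP => [p _ gp|/(_ q) //].
exact: is_age_inj gp gq.
Qed.

(* Main.v *)
Require Import Defs.
From mathcomp Require Import all_boot all_order all_algebra spectral.
From mathcomp Require Import fingroup perm.
From mathcomp Require Import complex.
From mathcomp Require Import boolp classical_sets cardinality reals.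
From mathcomp Require Import ring zify.

Set Implicit Arguments.
Unset Strict Implicit.
Unset Printing Implicit Defensive.

Import Order.TTheory GRing.Theory Num.Theory.

Local Open Scope classical_set_scope.
Local Open Scope ring_scope.
Local Open Scope sesquilinear_scope.

(** An eigenvalue exp (2 pi i a / r) other than 1 contributes a / r to the age
    of g and (r - a) / r to the age of the inverse of g.  So age g + age g^-1
    is the number of eigenvalues of g different from 1, and the hypothesis
    leaves at most two of them.  As det g = 1 they are inverse to each other,
    and tr g = 2 + 2 cos theta is real and nonnegative ([trace_ge_of_age]).
    Only this consequence of the age condition is used below.

    The traces of G add up to a positive number, because tr 1 = 4.  Their mean
    is the dimension of the space of fixed vectors, so G fixes a nonzero vector
    and acts on its orthogonal complement W, of dimension 3, with determinant 1
    and real character tr g - 1.  If G fixes a nonzero vector of W as well,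
    what remains is a plane and G lies in a conjugate of SU(2).

    Suppose that W has no nonzero fixed vector.  In dimension 3 the skew forms
    are the cross products by vectors, so W carries no nonzero invariant skew
    form, and every invariant bilinear form on W is symmetric
    ([invariant_form3_sym]).  On the other hand the character of W is real, so
    W is isomorphic to its dual, which means that W has a nondegenerate
    invariant bilinear form ([nondegenerate_invariant_form]).  This form is
    symmetric, and together with the invariant Hermitian product it defines a
    real structure: G becomes real orthogonal in a suitable orthonormal basis
    ([real_form]), hence lies in a conjugate of SO(3).

    The isomorphism between W and its dual is obtained without decomposing W
    into irreducibles: if an invariant symmetric form is degenerate, its
    radical again has a real character, and a mean over the group produces a
    nonzero invariant form on the radical, which raises the rank
    ([degenerate_form_improves]). *)

(** * Functional calculus for diagonalised matrices *)

Section SpectralCalculus.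
Variables (C : numClosedFieldType) (n : nat).
Implicit Types (f g : C -> C) (P Q M : 'M[C]_n) (d e : 'rV[C]_n).

(** The diagonalisation is an argument, because the transpose of a normal
    matrix inherits a diagonalisation that need not be the one chosen by
    [spectralmx]. *)
Definition spectral_fun f P d : 'M[C]_n := invmx P *m diag_mx (map_mx f d) *m P.

(** In eigenbases M has entries only between equal eigenvalues of the two
    matrices, and there applying f makes no difference.  This replaces the
    argument that f of a matrix is a polynomial in it. *)
Lemma spectral_fun_intertwine f P d Q e M :
    P \in unitmx -> Q \in unitmx ->
    spectral_fun id P d *m M = M *m spectral_fun id Q e ->
  spectral_fun f P d *m M = M *m spectral_fun f Q e.
Proof.
move=> Pu Qu; rewrite /spectral_fun !(map_mx_id (fun=> erefl)) => E.
pose N := P *m M *m invmx Q.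
have EN : diag_mx d *m N = N *m diag_mx e.
  have := congr1 (fun X => P *m X *m invmx Q) E.
  by rewrite /N !mulmxA mulmxV // mul1mx mulmxK.
have ME : M = invmx P *m N *m Q by rewrite /N !mulmxA mulVmx // mul1mx mulmxKV.
clearbody N.
have fN : diag_mx (map_mx f d) *m N = N *m diag_mx (map_mx f e).
  apply/matrixP=> i j; rewrite mul_diag_mx mul_mx_diag !mxE.
  have := congr1 (fun X : 'M_n => X i j) EN.
  rewrite mul_diag_mx mul_mx_diag !mxE.
  have [-> _|Nij] := eqVneq (N i j) 0; first by rewrite mulr0 mul0r.
  by rewrite [N i j * _]mulrC => /(mulIf Nij) ->; rewrite mulrC.
by rewrite ME !mulmxA !mulmxK // -(mulmxA _ _ N) fN !mulmxA.
Qed.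

Lemma spectral_fun_unique f P d Q e : P \in unitmx -> Q \in unitmx ->
  spectral_fun id P d = spectral_fun id Q e ->
  spectral_fun f P d = spectral_fun f Q e.
Proof.
move=> Pu Qu E; have := @spectral_fun_intertwine f P d Q e 1%:M Pu Qu.
by rewrite !mulmx1 !mul1mx; apply.
Qed.

Lemma spectral_funM f g P d : P \in unitmx ->
  spectral_fun f P d *m spectral_fun g P d = spectral_fun (fun x => f x * g x) P d.
Proof.
move=> Pu; rewrite /spectral_fun !mulmxA mulmxK //.
congr (_ *m _); rewrite -mulmxA mulmx_diag; congr (_ *m diag_mx _).
by apply/rowP=> i; rewrite !mxE.
Qed.

Lemma eq_spectral_fun f g P d : (forall i, f (d 0 i) = g (d 0 i)) ->
  spectral_fun f P d = spectral_fun g P d.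
Proof.
move=> fg; congr (_ *m diag_mx _ *m _); by apply/rowP=> i; rewrite !mxE.
Qed.

Lemma spectral_fun1 P d : P \in unitmx -> spectral_fun (fun=> 1) P d = 1%:M.
Proof.
move=> Pu; rewrite /spectral_fun.
have -> : map_mx (fun=> 1) d = const_mx 1 :> 'rV[C]_n by apply/rowP=> i; rewrite !mxE.
by rewrite diag_const_mx mulmx1 mulVmx.
Qed.

Lemma spectral_fun_eq1 f P d i : P \in unitmx ->
  spectral_fun f P d = 1%:M -> f (d 0 i) = 1.
Proof.
move=> Pu /(congr1 (fun X => P *m X *m invmx P)).
rewrite /spectral_fun !mulmxA mulmxV // mul1mx mulmxK // mulmx1 mulmxV //.
by move=> /matrixP/(_ i i); rewrite !mxE eqxx.
Qed.

Lemma spectral_fun_adjoint f P d : P \is unitarymx ->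
  (spectral_fun f P d)^t* = spectral_fun (fun x => (f x)^*) P d.
Proof.
move=> Pu; rewrite /spectral_fun invmx_unitary //.
rewrite !trmx_mul !map_mxM /= tr_diag_mx map_diag_mx.
rewrite trmxCK mulmxA; congr (_ *m diag_mx _ *m _).
by apply/rowP=> i; rewrite !mxE.
Qed.

Lemma spectral_fun_tr f P d :
  (spectral_fun f P d)^T = spectral_fun f (invmx P^T) d.
Proof. by rewrite /spectral_fun !trmx_mul tr_diag_mx trmx_inv invmxK mulmxA. Qed.

Lemma spectral_funE A : A \is normalmx ->
  A = spectral_fun id (spectralmx A) (spectral_diag A).
Proof.
by move/orthomx_spectralP=> {1}->; rewrite /spectral_fun (map_mx_id (fun=> erefl)).
Qed.

End SpectralCalculus.

(** * Gram matrices *)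

Section Gram.
Variables (C : numClosedFieldType) (n : nat).
Implicit Type A : 'M[C]_n.

Lemma gram_normal A : A^t* *m A \is normalmx.
Proof. by apply/normalmxP; rewrite trmx_mul map_mxM trmxCK. Qed.

Lemma mxtrace_gram_eq0 m p (A : 'M[C]_(m, p)) :
  \tr (A^t* *m A) = 0 -> A = 0.
Proof.
move=> /eqP; rewrite psumr_eq0 => [/allP E|j _]; last first.
  by rewrite mxE sumr_ge0 // => k _; rewrite !mxE mulrC mul_conjC_ge0.
apply/matrixP=> i j; rewrite mxE; apply/eqP.
have := E j; rewrite mem_index_enum /= mxE => /(_ isT).
rewrite psumr_eq0 => [/allP/(_ i)|k _]; last by rewrite !mxE mulrC mul_conjC_ge0.
by rewrite mem_index_enum !mxE mulrC mul_conjC_eq0 => /(_ isT).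
Qed.

Lemma gram_spectral_diag_gt0 A i : A \in unitmx ->
  0 < spectral_diag (A^t* *m A) 0 i.
Proof.
move=> Au; set H := A^t* *m A.
have PU := spectral_unitarymx H; have Pu := spectral_unit H.
set P := spectralmx H in PU Pu.
have dE : diag_mx (spectral_diag H) = (A *m P^t*)^t* *m (A *m P^t*).
  have /(congr1 (fun X => P *m X *m invmx P)) := spectral_funE (gram_normal A).
  rewrite /spectral_fun (map_mx_id (fun=> erefl)) -/P -/H !mulmxA mulmxV // mul1mx.
  by rewrite mulmxK // => <-; rewrite invmx_unitary // trmx_mul map_mxM trmxCK ?mulmxA.
have di : spectral_diag H 0 i != 0.
  have : diag_mx (spectral_diag H) \in unitmx.
    by rewrite dE !unitmx_mul map_unitmx unitmx_tr unitmx_mul Au map_unitmx unitmx_tr Pu.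
  by rewrite unitmxE det_diag unitfE => /prodf_neq0/(_ i isT).
rewrite lt_def di; have /matrixP/(_ i i) := dE; rewrite !mxE eqxx mulr1n => ->.
by apply: sumr_ge0 => k _; rewrite !mxE mulrC mul_conjC_ge0.
Qed.

(** For symmetric A the Gram matrix H = A^* A satisfies A H = H^T A, and this
    relation passes to functions of H. *)
Lemma form_gram_intertwine f A : A^T = A ->
  let F := spectral_fun f (spectralmx (A^t* *m A)) (spectral_diag (A^t* *m A)) in
  A *m F = F^T *m A.
Proof.
move=> At F; rewrite /F spectral_fun_tr; symmetry.
apply: spectral_fun_intertwine; rewrite ?unitmx_inv ?unitmx_tr ?spectral_unit //.
rewrite -spectral_fun_tr -spectral_funE ?gram_normal //.
by rewrite trmx_mul map_trmx trmxK At mulmxA.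
Qed.

End Gram.

(** * Finite unitary groups and their invariant bilinear forms *)

(** The elements are listed without repetition, so that sums over the group
    are sums over the list.  Closure under inverses follows from finiteness. *)
Definition finite_unitary_group (C : numClosedFieldType) n (s : seq 'M[C]_n) :=
  [/\ uniq s, 1%:M \in s, {in s &, forall g h, g *m h \in s}
    & {in s, forall g, g \is unitarymx}].

Definition invariant_form (C : numClosedFieldType) n (s : seq 'M[C]_n) A :=
  {in s, forall g, g^T *m A *m g = A}.

Definition fixes (C : numClosedFieldType) n (s : seq 'M[C]_n) (v : 'cV[C]_n) :=
  {in s, forall g, g *m v = v}.

(** Scalar products of matrix coefficients appear as entries of averaged
    matrix units. *)
Lemma trmx_delta_mulE (K : comPzRingType) n (Y : 'M[K]_n) i j k l :
  (Y^T *m delta_mx i j *m Y) k l = Y i k * Y j l.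
Proof.
rewrite mxE (bigD1 j) //= big1 ?addr0 => [|a aj].
  rewrite mxE (bigD1 i) //= big1 ?addr0 => [|a ai].
    by rewrite !mxE !eqxx mulr1.
  by rewrite !mxE (negPf ai) mulr0.
rewrite mxE big1 ?mul0r // => b _.
by rewrite !mxE (negPf aj) andbF mulr0.
Qed.

Section FiniteUnitaryGroup.
Variables (C : numClosedFieldType) (n : nat) (s : seq 'M[C]_n).
Hypothesis s_group : finite_unitary_group s.

Lemma perm_injective_image (f : 'M[C]_n -> 'M[C]_n) :
  {in s &, injective f} -> {in s, forall g, f g \in s} -> perm_eq (map f s) s.
Proof.
case: s_group => us _ _ _ fi fs.
have ufs : uniq (map f s) by rewrite map_inj_in_uniq.
apply: uniq_perm=> //.
have sub : {subset map f s <= s} by move=> _ /mapP[g gs ->]; apply: fs.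
by have [] := uniq_min_size ufs sub _; rewrite ?size_map.
Qed.

Lemma sum_group_mull (V : zmodType) (F : 'M[C]_n -> V) h : h \in s ->
  \sum_(g <- s) F (h *m g) = \sum_(g <- s) F g.
Proof.
case: s_group => us _ sM sU hs.
have hu := unitarymx_unit (sU _ hs).
rewrite -[RHS](perm_big _ (perm_injective_image (f := mulmx h) _ _)) ?big_map //.
- by move=> x y _ _ /(congr1 (mulmx (invmx h))); rewrite !mulKmx.
- by move=> g gs; apply: sM.
Qed.

Lemma sum_group_mulr (V : zmodType) (F : 'M[C]_n -> V) h : h \in s ->
  \sum_(g <- s) F (g *m h) = \sum_(g <- s) F g.
Proof.
case: s_group => us _ sM sU hs.
have hu := unitarymx_unit (sU _ hs).
rewrite -[RHS](perm_big _ (perm_injective_image (f := mulmx^~ h) _ _)) ?big_map //.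
- by move=> x y _ _ /(congr1 (mulmx^~ (invmx h))); rewrite !mulmxK.
- by move=> g gs; apply: sM.
Qed.

(** The sum of the group is a multiple of the projection onto the fixed
    vectors. *)
Lemma fixed_vector_of_trace :
  \sum_(g <- s) \tr g != 0 -> exists2 v, v != 0 & fixes s v.
Proof.
set pi := \sum_(g <- s) g.
have -> : \sum_(g <- s) \tr g = \tr pi by rewrite /pi raddf_sum.
move=> trpi; have [j pij] : exists j, col j pi != 0.
  case: (boolP [exists j, col j pi != 0]) => [/existsP//|/existsPn pi0].
  case/eqP: trpi; rewrite /mxtrace big1 // => i _.
  by have := pi0 i; rewrite negbK => /eqP/colP/(_ i); rewrite !mxE.
exists (col j pi) => // h hs; rewrite -[in RHS](_ : h *m pi = pi).
  by rewrite !colE mulmxA.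
by rewrite mulmx_sumr; apply: (sum_group_mull (fun g => g)).
Qed.

(** Invariant forms are the linear maps from the representation to its complex
    conjugate that commute with the group. *)
Lemma invariant_formE A : invariant_form s A <->
  {in s, forall g, A *m g = g^T^t* *m A}.
Proof.
case: s_group => _ _ _ sU; split=> H g gs; have gu := sU _ gs.
  have guT : g^T \is unitarymx by rewrite trmx_unitary.
  rewrite -{2}(H g gs) -invmx_unitary // !mulmxA mulVmx ?mul1mx //.
  exact: unitarymx_unit.
have guT : g^T \is unitarymx by rewrite trmx_unitary.
by rewrite -mulmxA H // mulmxA (unitarymxP guT) mul1mx.
Qed.

Lemma invariant_sum X : invariant_form s (\sum_(g <- s) g^T *m X *m g).
Proof.
move=> h hs; rewrite mulmx_sumr mulmx_suml.
rewrite -[RHS](sum_group_mulr (fun g => g^T *m X *m g) hs).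
by apply: eq_bigr=> g _; rewrite trmx_mul !mulmxA.
Qed.

Lemma spectral_gram_commute f A : A^T = A -> invariant_form s A ->
  let F := spectral_fun f (spectralmx (A^t* *m A)) (spectral_diag (A^t* *m A)) in
  {in s, forall g, F *m g = g *m F}.
Proof.
move=> At /invariant_formE Ai F g gs.
apply: spectral_fun_intertwine; rewrite ?spectral_unit //.
rewrite -spectral_funE ?gram_normal //.
rewrite -mulmxA (Ai _ gs) !mulmxA; congr (_ *m A).
have := congr1 (map_mx Num.conj) (Ai _ gs).
have gK : map_mx Num.conj (map_mx Num.conj g) = g.
  by apply/matrixP=> i j; rewrite !mxE conjCK.
by rewrite !map_mxM /= trmxK gK At.
Qed.

(** The matrix r is the orthogonal projection onto the complement of the
    radical of A.  Let q be the function of A^* A that inverts its nonzero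
    eigenvalues and keeps the zero ones.  Then q A^* is a pseudo-inverse of A and
    r = q A^* A.  So A identifies the image of r with its conjugate, and the
    character of the image of r equals its own conjugate. *)
Lemma invariant_form_support A : A^T = A -> invariant_form s A ->
  exists r : 'M[C]_n, [/\ A *m r = A /\ r *m r = r, r^t* = r,
   {in s, forall g, r *m g = g *m r},
   {in s, forall g, \tr (g *m r) \is Num.real} &
    r = 1%:M -> A \in unitmx].
Proof.
move=> At Ai; set H := A^t* *m A.
pose F f := spectral_fun f (spectralmx H) (spectral_diag H).
pose q := F (fun x => x^-1); pose r := F (fun x => (x != 0)%:R).
have Hu : spectralmx H \in unitmx by exact: spectral_unit.
have HE : H = F id by rewrite /F -spectral_funE // gram_normal.
have qH : q *m H = r.
  rewrite [in LHS]HE spectral_funM //; apply: eq_spectral_fun => i /=.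
  by have [->|x0] := eqVneq (spectral_diag H 0 i) 0; rewrite ?mulr0 // mulVf.
have Hq : H *m q = r.
  rewrite [in LHS]HE spectral_funM //; apply: eq_spectral_fun => i /=.
  by have [->|x0] := eqVneq (spectral_diag H 0 i) 0; rewrite ?mul0r // mulfV.
have Hr : H *m r = H.
  rewrite [in LHS]HE [RHS]HE spectral_funM //; apply: eq_spectral_fun => i /=.
  by have [->|x0] := eqVneq (spectral_diag H 0 i) 0; rewrite ?mul0r // mulr1.
have rr : r *m r = r.
  rewrite spectral_funM //; apply: eq_spectral_fun => i /=.
  by rewrite -natrM mulnb andbb.
have ra : r^t* = r.
  rewrite spectral_fun_adjoint ?spectral_unitarymx //; apply: eq_spectral_fun => i /=.
  by rewrite conjC_nat.
have Aq : A *m q = q^T *m A by apply: form_gram_intertwine.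
have rg : {in s, forall g, r *m g = g *m r} by exact: spectral_gram_commute.
clearbody q r; exists r; split=> //.
- split=> //; apply/eqP; rewrite -subr_eq0 -[X in _ - X]mulmx1 -mulmxBr; apply/eqP.
  apply: mxtrace_gram_eq0.
  by rewrite trmx_mul map_mxM mulmxA -(mulmxA _ _ A) -/H -mulmxA mulmxBr Hr mulmx1
    subrr mulmx0 mxtrace0.
- move=> g gs; rewrite CrealE; apply/eqP.
  have /invariant_formE AiE := Ai.
  transitivity (\tr (g^T^t* *m r^T)).
    rewrite -{1}ra trmxK -trace_map_mx map_mxM /=; congr (\tr (_ *m _)).
    by apply/matrixP => i j; rewrite !mxE conjCK.
  have HT : H^T = A *m A^t* by rewrite trmx_mul map_trmx trmxK At.
  rewrite -[in LHS]Hq trmx_mul HT [q^T *m _]mulmxA -Aq.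
  rewrite !mulmxA -AiE // -!mulmxA mxtrace_mulC -!mulmxA -/H.
  by rewrite qH.
- by move=> r1; move: (qH); rewrite r1 mulmxA => /mulmx1_unit[].
Qed.

Hypothesis s_real : {in s, forall g, \tr g \is Num.real}.

(** Let p be the projection onto the radical of A.  Averaging the matrix units
    over the group, compressed by p, gives invariant forms D X supported on the
    radical.  If all of them vanish, the sum of the squares of the real numbers
    tr (g p) vanishes; the term g = 1 then forces p = 0. *)
Lemma degenerate_form_improves A : A^T = A -> invariant_form s A ->
  A \notin unitmx -> exists2 B, invariant_form s B & (\rank A < \rank B)%N.
Proof.
move=> At Ai Au.
have [r [[Ar rr] ra rg tr r1]] := invariant_form_support At Ai.
pose p : 'M[C]_n := 1%:M - r.
have p0 : p != 0.
  by apply: contraNneq Au => /eqP; rewrite subr_eq0 eq_sym => /eqP/r1.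
have pa : p^t* = p by rewrite /p linearB /= map_mxB ra trmx1 map_mx1.
have pp : p *m p = p.
  by rewrite /p mulmxBr mulmx1 mulmxBl mul1mx rr subrr subr0.
have Ap : A *m p = 0 by rewrite /p mulmxBr mulmx1 Ar subrr.
have pA : p^T *m A = 0 by rewrite -{1}At -trmx_mul Ap trmx0.
have pg : {in s, forall g, p *m g = g *m p}.
  by move=> g gs; rewrite /p mulmxBr mulmxBl mulmx1 mul1mx rg.
have tp : {in s, forall g, \tr (g *m p) \is Num.real}.
  by move=> g gs; rewrite mulmxBr mulmx1 linearB rpredB ?tr ?s_real.
clearbody p.
pose D X := \sum_(g <- s) g^T *m (p^T *m X *m p) *m g.
have Di X : invariant_form s (D X) by exact: invariant_sum.
have DE X : D X = \sum_(g <- s) (g *m p)^T *m X *m (g *m p).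
  by apply: eq_big_seq => g gs; rewrite -(pg g gs) trmx_mul !mulmxA.
have Dp X : D X *m p = D X.
  by rewrite DE mulmx_suml; apply: eq_bigr => g _; rewrite -!mulmxA pp.
have ppT : p^T *m p^T = p^T by rewrite -trmx_mul pp.
have pD X : p^T *m D X = D X.
  by rewrite DE mulmx_sumr; apply: eq_bigr => g _; rewrite trmx_mul !mulmxA ppT.
have [X DX0] : exists X, D X != 0.
  case: (boolP [exists i, exists j, D (delta_mx i j) != 0]).
    by move=> /existsP[i /existsP[j Dij]]; exists (delta_mx i j).
  move=> /existsPn D0; case/eqP: p0.
  have sq0 : \sum_(g <- s) \tr (g *m p) ^+ 2 = 0.
    transitivity (\sum_i \sum_j D (delta_mx i j) i j).
      under eq_bigr => g _.
        rewrite expr2 [in X in X * _]/mxtrace mulr_suml.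
        under eq_bigr do rewrite mulr_sumr.
        over.
      rewrite exchange_big; apply: eq_bigr => i _ /=.
      rewrite exchange_big; apply: eq_bigr => j _ /=.
      rewrite DE summxE; apply: eq_bigr => g _.
      by rewrite trmx_delta_mulE.
    rewrite big1 // => i _; rewrite big1 // => j _.
    by have /existsPn/(_ j) := D0 i; rewrite negbK => /eqP->; rewrite mxE.
  case: s_group => _ s1 _ _.
  move/eqP: sq0; rewrite big_seq psumr_eq0 => [/allP/(_ _ s1)|g gs]; last first.
    by rewrite real_exprn_even_ge0 ?tp.
  rewrite s1 mul1mx sqrf_eq0 => /eqP trp.
  by apply: mxtrace_gram_eq0; rewrite pa pp.
exists (A + D X).
  by move=> g gs; rewrite mulmxDr mulmxDl Ai // Di.
(* Multiplication by p kills A and fixes D X, so the kernel of A + D X is the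
   intersection of both kernels; the rows of p^T lie in the kernel of A only. *)
have kA : (kermx (A + D X) < kermx A)%MS.
  have ADp Y : Y *m (A + D X) = 0 -> Y *m A = 0 /\ Y *m D X = 0.
    move=> Y0.
    have YD : Y *m D X = 0.
      have := congr1 (mulmx^~ p) Y0.
      by rewrite mul0mx -mulmxA mulmxDl Ap add0r Dp.
    by split=> //; move: Y0; rewrite mulmxDr YD addr0.
  apply/andP; split.
    by apply/sub_kermxP; have [] := ADp _ _ (mulmx_ker (A + D X)).
  apply/negP => /(submx_trans (_ : p^T <= kermx A)%MS).
  have -> : (p^T <= kermx A)%MS by apply/sub_kermxP.
  move=> /(_ isT)/sub_kermxP/ADp[_].
  by apply/eqP; rewrite pD.
rewrite ltnNge; apply/negP => le_rank; move: (rank_ltmx kA).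
by rewrite !mxrank_ker ltnNge leq_sub2l.
Qed.

Lemma nondegenerate_invariant_form :
    (forall A, invariant_form s A -> A^T = A) ->
  exists2 A, invariant_form s A & A \in unitmx.
Proof.
move=> sym.
have : invariant_form s 0 by move=> g _; rewrite mulmx0 mul0mx.
have [k] := ubnP (n - \rank (0%R : 'M[C]_n))%N.
elim: k (0 : 'M[C]_n) => // k IHk A ltk Ai.
have [Au|Au] := boolP (A \in unitmx); first by exists A.
have [B Bi AB] := degenerate_form_improves (sym A Ai) Ai Au.
apply: (IHk B) => //; apply: leq_trans (ltk : (_ <= k)%N).
by rewrite ltn_sub2l // (leq_trans AB) // rank_leq_row.
Qed.

(** A nondegenerate symmetric invariant form A has a polar decomposition whose
    unitary part S = A (A^* A)^(-1/2) is again symmetric and invariant.  Its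
    square root T is symmetric and unitary.  The relation S g = conj(g) S with
    S = T T says that T g T^* equals its own complex conjugate. *)
Theorem real_form : (forall A, invariant_form s A -> A^T = A) ->
  exists2 U : 'M[C]_n, U \is unitarymx &
    {in s, forall g, U *m g *m U^t* \is a realmx}.
Proof.
move=> sym.
have [A Ai Au] := nondegenerate_invariant_form sym.
have At := sym A Ai.
set H := A^t* *m A.
pose F f := spectral_fun f (spectralmx H) (spectral_diag H).
have Hu : spectralmx H \in unitmx by exact: spectral_unit.
have HE : H = F id by rewrite /F -spectral_funE // gram_normal.
have d_gt0 i : 0 < spectral_diag H 0 i.
  exact: gram_spectral_diag_gt0.
pose N := F (fun x => (sqrtC x)^-1).
have AN : A *m N = N^T *m A by apply: form_gram_intertwine.
have Ng : {in s, forall g, N *m g = g *m N} by exact: spectral_gram_commute.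
have Na : N^t* = N.
  rewrite /N spectral_fun_adjoint ?spectral_unitarymx //.
  by apply: eq_spectral_fun => i /=; rewrite geC0_conj // invr_ge0 sqrtC_ge0 ltW.
have NHN : N *m H *m N = 1%:M.
  rewrite [in LHS]HE !spectral_funM //.
  rewrite -(spectral_fun1 (spectral_diag H) Hu); apply: eq_spectral_fun => i /=.
  by rewrite -{2}(sqrtCK (spectral_diag H 0 i)) expr2 mulKf ?mulfV // sqrtC_eq0 gt_eqF.
clearbody N.
pose S := A *m N.
have St : S^T = S by rewrite /S trmx_mul At AN.
have SU : S \is unitarymx.
  rewrite -trmxC_unitary; apply/unitarymxP; rewrite trmxCK.
  by rewrite /S trmx_mul map_mxM /= Na -!mulmxA [A^t* *m _]mulmxA -/H mulmxA.
have Si : invariant_form s S.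
  apply/invariant_formE => g gs.
  rewrite /S -mulmxA Ng // !mulmxA; congr (_ *m _).
  by move/invariant_formE: Ai => ->.
have Sn : S \is normalmx.
  by apply/normalmxP; rewrite (unitarymxP SU) (mulmx1C (unitarymxP SU)).
pose T := spectral_fun sqrtC (spectralmx S) (spectral_diag S).
have Pu : spectralmx S \in unitmx by exact: spectral_unit.
have PU : spectralmx S \is unitarymx by exact: spectral_unitarymx.
have SE := spectral_funE Sn.
have TT : T *m T = S.
  rewrite [RHS]SE spectral_funM //; apply: eq_spectral_fun => i /=.
  by rewrite -expr2 sqrtCK.
have Tt : T^T = T.
  rewrite /T spectral_fun_tr; apply: spectral_fun_unique.
  - by rewrite unitmx_inv unitmx_tr.
  - by [].
  - by rewrite -spectral_fun_tr -SE.
have TU : T \is unitarymx.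
  apply/unitarymxP; rewrite /T spectral_fun_adjoint // spectral_funM //.
  rewrite -(spectral_fun1 (spectral_diag S) Pu); apply: eq_spectral_fun => i /=.
  have /unitarymxP := SU; rewrite {1 2}SE spectral_fun_adjoint // spectral_funM //.
  move=> /(spectral_fun_eq1 i Pu) /=; rewrite -!normCK -{1}(sqrtCK (_ 0 i)) normrX.
  by move/eqP; rewrite sqrp_eq1 ?exprn_ge0 // => /eqP.
clearbody T; exists T => // g gs.
have Tc : map_mx Num.conj T = T^t* by rewrite Tt.
have E : T *m g *m T^t* = T^t* *m map_mx Num.conj g *m T.
  have /invariant_formE/(_ g gs) := Si; rewrite trmxK -TT => E.
  have TU' := mulmx1C (unitarymxP TU).
  have := congr1 (fun X => T^t* *m X *m T^t*) E.
  rewrite !mulmxA TU' mul1mx => ->.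
  by rewrite -!mulmxA (unitarymxP TU) mulmx1.
have cE : map_mx Num.conj (T *m g *m T^t*) = T *m g *m T^t*.
  rewrite !map_mxM /= Tc [RHS]E; congr (_ *m _).
  by rewrite -[in RHS](trmxCK T) Tt map_trmx Tt.
apply/mxOverP => i j; rewrite CrealE; apply/eqP.
by have /matrixP/(_ i j) := cE; rewrite mxE.
Qed.

End FiniteUnitaryGroup.

(** * Skew forms in dimension three *)

Section CrossProduct.
Variable K : comNzRingType.

(** Indices are taken modulo 3.  The index 2 is written 1 + 1 throughout, so
    that sums, determinants and entries reduce to the same three ordinals. *)
Definition cross_mx (w : 'cV[K]_3) : 'M[K]_3 :=
  \matrix_(i, j) if j == i + 1 then w (j + 1) 0
                 else if i == j + 1 then - w (i + 1) 0 else 0.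

Lemma sum_ord3 (F : 'I_3 -> K) : \sum_i F i = F 0 + F 1 + F (1 + 1).
Proof.
rewrite !big_ord_recl big_ord0 addr0 addrA.
by congr (F _ + F _ + F _); apply: val_inj.
Qed.

Lemma ord3P (P : 'I_3 -> Prop) : P 0 -> P 1 -> P (1 + 1) -> forall i, P i.
Proof.
move=> P0 P1 P2 [[|[|[|//]]] lti].
- by rewrite (_ : Ordinal _ = 0) //; apply: val_inj.
- by rewrite (_ : Ordinal _ = 1) //; apply: val_inj.
- by rewrite (_ : Ordinal _ = 1 + 1) //; apply: val_inj.
Qed.

Lemma det_mx33 (g : 'M[K]_3) : \det g =
  g 0 0 * (g 1 1 * g (1 + 1) (1 + 1) - g 1 (1 + 1) * g (1 + 1) 1)
  - g 0 1 * (g 1 0 * g (1 + 1) (1 + 1) - g 1 (1 + 1) * g (1 + 1) 0)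
  + g 0 (1 + 1) * (g 1 0 * g (1 + 1) 1 - g 1 1 * g (1 + 1) 0).
Proof.
pose G (i j : nat) := g (inord i) (inord j).
have gE i j : g i j = G i j by rewrite /G !inord_val.
rewrite (expand_det_row _ 0) !big_ord_recl big_ord0 /cofactor.
rewrite !(expand_det_row _ 0) !big_ord_recl !big_ord0 /cofactor !det_mx11 !mxE.
rewrite !gE /=.
rewrite /bump /= !(addnE, addn0, expr0, expr1, mul1r).
by ring.
Qed.

(** The triple product det (x, y, w) is multiplied by det g when g is applied
    to x, y and w. *)
Lemma cross_mxM (g : 'M[K]_3) w :
  g^T *m cross_mx (g *m w) *m g = \det g *: cross_mx w.
Proof.
have s0 : (1 + 1 + 1 : 'I_3) = 0 by apply: val_inj.
rewrite det_mx33; apply/matrixP; apply: ord3P; apply: ord3P;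
  rewrite !(mxE, sum_ord3) /= ?s0 ?add0r /=; ring.
Qed.

Lemma skew3_cross (A : 'M[K]_3) :
  (forall i, A i i = 0) -> A^T = - A -> exists w, A = cross_mx w.
Proof.
move=> A0 At; exists (\col_i A (i + 1) (i + 1 + 1)).
have s0 : (1 + 1 + 1 : 'I_3) = 0 by apply: val_inj.
have AN i j : A i j = - A j i by have /matrixP/(_ j i) := At; rewrite !mxE.
by apply/matrixP; apply: ord3P; apply: ord3P;
  rewrite !mxE /= ?s0 ?add0r // ?s0 AN ?A0 ?oppr0.
Qed.

Lemma cross_mx_inj : injective cross_mx.
Proof.
move=> v w E; apply/colP => i.
have /matrixP/(_ (i + 1) (i + 1 + 1)) := E; rewrite !mxE eqxx.
have -> : i + 1 + 1 + 1 = i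
  by move: i {E}; apply: ord3P; apply: val_inj.
by [].
Qed.

End CrossProduct.

(** If A is invariant, A^T - A is the cross product by a vector w.  For det g = 1
    the invariance of this form means g w = w. *)
Lemma invariant_form3_sym (C : numClosedFieldType) (s : seq 'M[C]_3) A :
    finite_unitary_group s ->
    {in s, forall g, \det g = 1} -> (forall v, fixes s v -> v = 0) ->
  invariant_form s A -> A^T = A.
Proof.
move=> [us s1 sM sU] sdet sfix Ai.
pose B := A^T - A.
have Bt : B^T = - B by rewrite /B linearB /= trmxK opprB.
have B0 i : B i i = 0 by rewrite !mxE subrr.
have Bi : invariant_form s B.
  move=> g gs; rewrite /B mulmxBr mulmxBl; congr (_ - _); last exact: Ai.
  by rewrite -{2}(Ai g gs) !trmx_mul trmxK mulmxA.
have [w Bw] := skew3_cross B0 Bt.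
apply/eqP; rewrite -subr_eq0 -/B Bw.
suff -> : w = 0.
  by apply/eqP/matrixP => i j; rewrite !mxE oppr0 !if_same.
apply: sfix => g gs.
have gu := unitarymx_unit (sU g gs).
have : cross_mx (g *m w) = cross_mx w.
  have := cross_mxM g w; rewrite sdet // scale1r -{1}Bw -{1}(Bi g gs).
  move=> /(congr1 (mulmx^~ (invmx g))); rewrite !mulmxK // Bw.
  move=> /(congr1 (mulmx (invmx g^T))).
  by rewrite !mulKmx ?unitmx_tr.
exact: cross_mx_inj.
Qed.

(** * Splitting off a fixed vector *)

Section Splitting.
Variable C : numClosedFieldType.

(** The last row of U is proportional to v^*, which every g fixes from the right.
    So the last row of U g U^* is the last basis vector, and the same holds for
    the last column because U g U^* is unitary. *)
Lemma fixed_vector_complement n (s : seq 'M[C]_(n + 1)) (v : 'cV[C]_(n + 1)) :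
    {in s, forall g, g \is unitarymx} -> v != 0 -> fixes s v ->
  exists2 U : 'M[C]_(n + 1), U \is unitarymx &
    {in s, forall g, U *m g *m U^t* = block_mx (ulsubmx (U *m g *m U^t*)) 0 0 1%:M}.
Proof.
move=> sU v0 sv.
pose k : 'I_(n + 1) := rshift n ord0.
have [U UU [c Uk]] : exists2 U : 'M[C]_(n + 1), U \is unitarymx &
    exists c, row k U = c *: v^t*.
  (* Gram-Schmidt applied to a matrix whose first row is v^* makes v^* a
     multiple of the first row; that row is then exchanged with the last. *)
  pose i0 : 'I_(n + 1) := cast_ord (addnC 1 n) ord0.
  pose S := schmidt (\matrix_(i < n + 1, j < n + 1) (v j 0)^*).
  have SU : S \is unitarymx by apply: schmidt_unitarymx.
  have [a vS] : exists a, v^t* = a *: row i0 S.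
    apply/sub_rVP; have := row_schmidt_sub (\matrix_(i < n + 1, j < n + 1) (v j 0)^*) i0.
    rewrite -/S (big_pred1 i0) => [|i]; last by rewrite leqn0.
    by rewrite genmxE; congr (_ <= _)%MS; apply/rowP => j; rewrite !mxE.
  have a0 : a != 0.
    apply: contraNneq v0 => a0; move: vS; rewrite a0 scale0r => /rowP vS.
    apply/eqP/colP => i; have := vS i; rewrite !mxE => /eqP.
    by rewrite conjC_eq0 => /eqP.
  exists (xrow i0 k S).
    rewrite xrowE mul_unitarymx //; apply/unitarymxP.
    by rewrite tr_tperm_mx map_tperm_mx -perm_mxM tperm2 perm_mx1.
  exists a^-1; rewrite vS scalerA mulVf // scale1r.
  by apply/rowP => j; rewrite !mxE tpermR.
exists U => // g gs; set M := U *m g *m U^t*.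
have MU : M \is unitarymx.
  by rewrite !mul_unitarymx ?trmxC_unitary // sU.
have vg : v^t* *m g = v^t*.
  rewrite -{1}(sv g gs) trmx_mul map_mxM /= -mulmxA.
  by rewrite (mulmx1C (unitarymxP (sU g gs))) mulmx1.
have Mk : row k M = delta_mx 0 k.
  rewrite /M !row_mul Uk -scalemxAl vg -Uk -row_mul (unitarymxP UU).
  by rewrite row1.
have Mk' : row k (M^t*) = delta_mx 0 k.
  have := congr1 (fun X => X *m M^t*) Mk; rewrite -row_mul (unitarymxP MU) row1.
  by rewrite -rowE => <-.
rewrite -[LHS]submxK; congr block_mx.
- apply/matrixP => i j; have /rowP/(_ (lshift 1 i)) := Mk'; rewrite !mxE ord1.
  by rewrite -/k eq_lrshift andbF => /eqP; rewrite conjC_eq0 => /eqP.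
- apply/matrixP => i j; have /rowP/(_ (lshift 1 j)) := Mk; rewrite !mxE ord1.
  by rewrite -/k eq_lrshift andbF.
- apply/matrixP => i j; have /rowP/(_ k) := Mk; rewrite !mxE !ord1.
  by rewrite -/k !eqxx.
Qed.

Section Compression.
Variables (n : nat) (s : seq 'M[C]_(n + 1)) (U : 'M[C]_(n + 1)).
Let f g := ulsubmx (U *m g *m U^t*).
Hypothesis sG : finite_unitary_group s.
Hypothesis UU : U \is unitarymx.
Hypothesis split : {in s, forall g, U *m g *m U^t* = block_mx (f g) 0 0 1%:M}.

(** The group induced on the complement of the fixed vector. *)
Definition compression := undup (map f s).

Lemma compression_group : finite_unitary_group compression.
Proof.
case: sG => us s1 sM sU.
have UUC := mulmx1C (unitarymxP UU).
have f1 : f 1%:M = 1%:M.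
  by rewrite /f mulmx1 (unitarymxP UU) (@scalar_mx_block _ n 1) block_mxKul.
have fM : {in s &, forall g h, f (g *m h) = f g *m f h}.
  move=> g h gs hs; have := split (sM g h gs hs).
  have -> : U *m (g *m h) *m U^t* = (U *m g *m U^t*) *m (U *m h *m U^t*).
    by rewrite !mulmxA -(mulmxA _ (U^t*) U) UUC mulmx1.
  rewrite split // (split hs) mulmx_block => /eq_block_mx[<- _ _ _].
  by rewrite mulmx0 addr0.
have mem h : reflect (exists2 g, g \in s & h = f g) (h \in compression).
  by rewrite /compression mem_undup; apply: mapP.
split; rewrite ?undup_uniq //.
- by apply/mem; exists 1%:M.
- move=> _ _ /mem[g gs ->] /mem[h hs ->]; apply/mem.
  by exists (g *m h); rewrite ?fM ?sM.
- move=> _ /mem[g gs ->]; apply/unitarymxP.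
  have : U *m g *m U^t* \is unitarymx by rewrite !mul_unitarymx ?trmxC_unitary // sU.
  rewrite split // => /unitarymxP.
  rewrite tr_block_mx map_block_mx mulmx_block (@scalar_mx_block _ n 1).
  by move=> /eq_block_mx[+ _ _ _]; rewrite trmx0 mul0mx addr0.
Qed.

Lemma compression_det g : g \in s -> \det (f g) = \det g.
Proof.
move=> gs; have := congr1 determinant (split gs).
rewrite det_ublock det1 mulr1 => <-.
by rewrite !det_mulmx mulrAC -det_mulmx (unitarymxP UU) det1 mul1r.
Qed.

Lemma compression_trace g : g \in s -> \tr (f g) = \tr g - 1.
Proof.
move=> gs; have := congr1 mxtrace (split gs).
rewrite mxtrace_block mxtrace1 => /(canLR (addrK _)) <-.
by rewrite mxtrace_mulC mulmxA (mulmx1C (unitarymxP UU)) mul1mx.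
Qed.

End Compression.

Lemma conj_block n (V h : 'M[C]_n) :
  let W : 'M_(n + 1) := block_mx V 0 0 1%:M in
  W *m (block_mx h 0 0 1%:M) *m W^t* = block_mx (V *m h *m V^t*) 0 0 1%:M.
Proof.
move=> W; rewrite /W tr_block_mx map_block_mx !mulmx_block !trmx0 !map_mx0 trmx1 map_mx1.
by rewrite !mulmx0 !mul0mx !addr0 !add0r !mulmx1 ?mul0mx.
Qed.

Lemma block_unitary n (V : 'M[C]_n) :
  ((block_mx V 0 0 1%:M : 'M_(n + 1)) \is unitarymx) = (V \is unitarymx).
Proof.
have /= E := conj_block V 1%:M; rewrite -scalar_mx_block !mulmx1 in E.
apply/unitarymxP/unitarymxP => [|VU]; last by rewrite E VU -scalar_mx_block.
by rewrite E (@scalar_mx_block _ n 1) => /eq_block_mx[].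
Qed.

Lemma block_mx_nested (h : 'M[C]_2) :
  block_mx (block_mx h 0 0 1%:M : 'M_(2 + 1)) 0 0 1%:M
  = block_mx h 0 0 1%:M :> 'M_(2 + 2).
Proof.
(* The dimensions 2 + (1 + 1) and (2 + 1) + 1 are convertible, so the cast in the
   associativity law of block matrices is the identity. *)
have /= := @block_mxA _ 2 1 1 2 1 1 h 0 0 0 1%:M 0 0 0 1%:M.
by rewrite castmx_id !row_mx0 !col_mx0 -scalar_mx_block => <-.
Qed.

End Splitting.

(** Both cases apply [fixed_vector_complement] to the whole group first; the
    alternative is whether the group t induced on the complement has a nonzero
    fixed vector. *)
Theorem finite_unitary4_split (C : numClosedFieldType)
    (s : seq 'M[C]_(3 + 1)) :
    finite_unitary_group s -> {in s, forall g, \det g = 1} ->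
    {in s, forall g, 0 <= \tr g} ->
  exists2 U : 'M[C]_(3 + 1), U \is unitarymx &
    {in s, forall g, exists h : 'M[C]_3, [/\ h \is unitarymx, \det h = 1,
       h \is a realmx & U *m g *m U^t* = block_mx h 0 0 1%:M]} \/
    {in s, forall g, exists h : 'M[C]_2, [/\ h \is unitarymx, \det h = 1 &
       U *m g *m U^t* = block_mx h 0 0 1%:M :> 'M_(2 + 2)]}.
Proof.
move=> sG sdet str; have [_ s1 _ sU] := sG.
have [v v0 sv] : exists2 v, v != 0 & fixes s v.
  apply: fixed_vector_of_trace => //; rewrite gt_eqF //.
  rewrite (big_rem _ s1) /= ltr_pwDl //; first by rewrite mxtrace1 ltr0n.
  by rewrite big_seq sumr_ge0 // => g /mem_rem/str.
have [U UU split] := fixed_vector_complement sU v0 sv.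
have tG := compression_group sG UU split; have [_ _ _ tU] := tG.
set t := compression s U in tG tU.
have tP h : h \in t -> exists2 g, g \in s & h = ulsubmx (U *m g *m U^t*).
  by rewrite mem_undup => /mapP.
have tmem g : g \in s -> ulsubmx (U *m g *m U^t*) \in t.
  by move=> gs; rewrite mem_undup; apply: map_f gs.
have tdet : {in t, forall h, \det h = 1}.
  by move=> h /tP[g gs ->]; rewrite (compression_det UU split gs) sdet.
have ttr : {in t, forall h, \tr h \is Num.real}.
  move=> h /tP[g gs ->]; rewrite (compression_trace UU split gs).
  by rewrite rpredB ?rpred1 // ger0_real ?str.
clearbody t.
have lift (V : 'M[C]_3) : V \is unitarymx ->
    exists2 W : 'M[C]_(3 + 1), W \is unitarymx & {in s, forall g, exists2 h,
      [/\ h \in t, V *m h *m V^t* \is unitarymx & \det (V *m h *m V^t*) = 1]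
      & W *m g *m W^t* = block_mx (V *m h *m V^t*) 0 0 1%:M}.
  move=> VU; exists ((block_mx V 0 0 1%:M : 'M_(3 + 1)) *m U).
    by rewrite mul_unitarymx ?block_unitary.
  move=> g gs; have ht := tmem g gs; exists (ulsubmx (U *m g *m U^t*)).
    split=> //; first by rewrite !mul_unitarymx ?trmxC_unitary // tU.
    by rewrite !det_mulmx mulrAC -det_mulmx (unitarymxP VU) det1 mul1r tdet.
  by rewrite trmx_mul map_mxM -conj_block -(split g gs) !mulmxA.
have [[w w0 tw]|nofix] := pselect (exists2 w, w != 0 & fixes t w).
  have [V VU Vsplit] := fixed_vector_complement (n := 2) tU w0 tw.
  have [W WU WE] := lift V VU; exists W => //; right=> g /WE[h [ht hU hdet] ->].
  move: hU hdet; rewrite (Vsplit h ht) (block_unitary (n := 2)).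
  rewrite (@det_ublock _ 2 1) det1 mulr1 => hU hdet.
  by eexists; split; [exact: hU | exact: hdet | exact: block_mx_nested].
have sym A : invariant_form t A -> A^T = A.
  apply: invariant_form3_sym => // w tw.
  by apply/eqP/negPn/negP => w0; apply: nofix; exists w.
have [V VU Vreal] := real_form tG ttr sym.
have [W WU WE] := lift V VU; exists W => //; left=> g /WE[h [ht hU hdet] ->].
by exists (V *m h *m V^t*); split=> //; apply: Vreal.
Qed.

(** * The age condition *)

(** The second summand is the conjugate of the first, and the sum exceeds -2 by
    the square of the absolute value of 1 + x. *)
Lemma conj_pair_ge (C : numClosedFieldType) (x y : C) : `|x| = 1 -> x * y = 1 ->
  -2 <= x + y.
Proof.
move=> x1 xy; have x0 : x != 0 by rewrite -normr_gt0 x1 ltr01.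
have xx : x * x^* = 1 by rewrite -normCK x1 expr1n.
have -> : y = x^* by apply: (mulfI x0); rewrite xy xx.
rewrite -subr_ge0; have -> : x + x^* - -2 = (1 + x) * (1 + x)^*.
  by rewrite rmorphD rmorph1 mulrDl !mulrDr xx; ring.
exact: mul_conjC_ge0.
Qed.

Section Age.
Variables (R : realType) (n : nat).
Local Notation C := R[i].

(** Two of the first |s| + 1 powers of g coincide. *)
Lemma group_has_order (s : seq 'M[C]_n.+1) g :
  finite_unitary_group s -> g \in s -> exists r, has_order g r.
Proof.
move=> [us s1 sM sU] gs.
have gu : (g : 'M[C]_n.+1) \is a GRing.unit := unitarymx_unit (sU g gs).
have gX k : g ^+ k \in s by elim: k => [|k IHk]; rewrite ?expr0 // exprS; apply: sM.
have : exists k, (0 < k)%N && (g ^+ k == 1%:M).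
  have : ~~ uniq [seq g ^+ k | k <- iota 0 (size s).+1].
    apply/negP => us'; suff : (size [seq g ^+ k | k <- iota 0 (size s).+1] <= size s)%N.
      by rewrite size_map size_iota ltnn.
    by apply: uniq_leq_size us' _ => _ /mapP[k _ ->].
  case/(uniqPn 0) => i [j [ij]]; rewrite size_map size_iota => js.
  have is' := ltn_trans ij js.
  rewrite !(nth_map 0%N) ?size_iota // !nth_iota // !add0n => E.
  exists (j - i)%N; rewrite subn_gt0 ij /=; apply/eqP.
  by apply: (mulrI (unitrX i gu)); rewrite -exprD subnKC ?(ltnW ij) // -E mulr1.
move=> ex; case: (ex_minnP ex) => r /andP[r0 /eqP gr] rmin.
exists r; split=> // k /andP[k0 kr] gk.
by have := rmin k; rewrite k0 gk eqxx leqNgt kr => /(_ isT).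
Qed.

(** In the same eigenbasis the inverse has the exponents r - a i, except that
    the exponent 0 stays 0. *)
Lemma is_age_inv (g P : 'M[C]_n.+1) r (a : 'I_n.+1 -> nat) :
    has_order g r -> P \in unitmx -> (forall i, (a i < r)%N) ->
    invmx P *m g *m P = diag_mx (\row_i epsilon R r ^+ a i) ->
  is_age (invmx g) ((\sum_i (if a i == 0 then 0 else r - a i))%N%:R / r%:R).
Proof.
move=> [r0 gr rmin] Pu ar gP.
have eu : epsilon R r != 0.
  apply/eqP => e0; have := prim_expr_order (epsilon_prim R r0).
  by rewrite e0 expr0n gtn_eqF // => /eqP; rewrite eq_sym oner_eq0.
have gE : g = P *m diag_mx (\row_i epsilon R r ^+ a i) *m invmx P.
  by rewrite -gP !mulmxA mulmxV // mul1mx mulmxK.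
have gu : g \in unitmx.
  rewrite gE !unitmx_mul Pu unitmx_inv Pu andbT /= unitmxE det_diag unitfE.
  by apply/prodf_neq0 => i _; rewrite mxE expf_neq0.
have gVX k : (invmx g) ^+ k = invmx (g ^+ k) by exact: (exprVn (g : 'M_n.+1)).
exists r, P, (fun i => if a i == 0 then 0 else r - a i)%N; split=> //.
- split=> // [|k kr]; first by rewrite gVX gr invmx1.
  by rewrite gVX => /(congr1 invmx); rewrite invmxK invmx1; apply: rmin.
- by move=> i; case: eqP => // /eqP; rewrite -lt0n; have := ar i; lia.
have : (invmx P *m g *m P) *m (invmx P *m invmx g *m P) = 1%:M.
  by rewrite !mulmxA mulmxK // -(mulmxA _ g) mulmxV // mulmx1 mulVmx.
rewrite gP; set D := diag_mx _ => DV.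
have DD : diag_mx (\row_i epsilon R r ^+ (if a i == 0 then 0 else r - a i)%N) *m D = 1%:M.
  rewrite mulmx_diag; apply/matrixP => i j; rewrite !mxE; congr (_ *+ _).
  case: eqP => [->|_]; rewrite ?mulr1 // -exprD subnK ?(ltnW (ar i)) //.
  exact: (prim_expr_order (epsilon_prim R r0)).
by rewrite -[RHS]mulmx1 -DV [RHS]mulmxA DD mul1mx.
Qed.

(** The set S indexes the eigenvalues different from 1, and the sum of the two
    ages is #|S|, so #|S| <= 2.  The eigenvalues outside S contribute
    n + 1 - #|S| to the trace.  The product of those in S is 1, so a single one
    would be 1, and two of them add up to at least -2. *)
Lemma trace_ge_of_age (g : 'M[C]_n.+1) r : has_order g r -> \det g = 1 ->
  age g <= 1 -> age (invmx g) <= 1 -> n.+1%:R - 4 <= \tr g.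
Proof.
move=> gord gdet; have [q gq] := is_age_ex gord.
rewrite (ageE gq); case: gq => {}r [P [a [{}gord Pu ar gP ->]]].
have [r0 _ _] := gord.
have pe := epsilon_prim R r0.
rewrite (ageE (is_age_inv gord Pu ar gP)) => age1 age2.
pose x i := epsilon R r ^+ a i.
have xE : \tr g = \sum_i x i.
  rewrite -[g]mulmx1 -(mulmxV Pu) mulmxA mxtrace_mulC mulmxA gP mxtrace_diag.
  by apply: eq_bigr => i _; rewrite mxE.
have xprod : \prod_i x i = 1.
  have := congr1 determinant gP; rewrite !det_mulmx mulrAC -det_mulmx mulVmx //.
  rewrite det1 mul1r gdet det_diag => xp; rewrite [RHS]xp.
  by apply: eq_bigr => i _; rewrite mxE.
have xnorm i : `|x i| = 1.
  have : `|epsilon R r| ^+ r = 1 by rewrite -normrX (prim_expr_order pe) normr1.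
  move/eqP; rewrite pexpr_eq1 // => /eqP e1.
  by rewrite /x normrX e1 expr1n.
pose S := [set i | a i != 0%N]%SET.
have x1 i : i \notin S -> x i = 1 by rewrite inE negbK /x => /eqP->.
have S2 : (#|S| <= 2)%N.
  have E : (\sum_i a i + \sum_i (if a i == 0 then 0 else r - a i) = #|S| * r)%N.
    rewrite -big_split -sum_nat_const [RHS]big_mkcond; apply: eq_bigr => i _ /=.
    by rewrite inE; case: eqP => [->|_] //=; rewrite subnKC // ltnW.
  move: age1 age2; rewrite !ler_pdivrMr ?ltr0n // !mul1r !ler_nat => l1 l2.
  by rewrite -(leq_pmul2r r0) -E mul2n -addnn leq_add.
have sumS : \tr g = n.+1%:R - #|S|%:R + \sum_(i in S) x i.
  rewrite xE (bigID (mem S)) /= addrC; congr (_ + _).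
  rewrite (eq_bigr (fun=> 1)) => [|i /x1//].
  rewrite sumr_const; have -> : #|[pred i | i \notin S]| = (n.+1 - #|S|)%N.
    transitivity #|(~: S)%SET|; first by apply: eq_card => i; rewrite !inE.
    by rewrite cardsCs finset.setCK card_ord.
  by rewrite natrB // (leq_trans (max_card _)) ?card_ord.
have prodS : \prod_(i in S) x i = 1.
  by rewrite -[RHS]xprod [RHS](bigID (mem S)) /= [X in _ * X]big1 ?mulr1 // => i /x1.
rewrite sumS -addrA lerD2l.
have : [|| #|S| == 0, #|S| == 1 | #|S| == 2]%N by lia.
case/or3P=> [/eqP S0|/cards1P[i Si]|/cards2P[i [j [ij Sij]]]].
- move/eqP: (S0); rewrite cards_eq0 => /eqP S00.
  by rewrite S0 S00 big_set0 mulr0n oppr0 addr0 oppr_le0 ler0n.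
- move: prodS; rewrite Si big_set1 cards1 big_set1 => ->.
  by rewrite addNr oppr_le0 ler0n.
- move: prodS; rewrite Sij !big_setU1 ?inE //= !big_set1 cards2 ij => xij.
  have := conj_pair_ge (xnorm i) xij.
  move=> h; have := lerD (lexx (- 2)) h.
  by rewrite (_ : - 2 + - 2 = - 4 :> C) //; ring.
Qed.

End Age.

(** * The classification *)

Lemma realmx_SO (R : realType) n (M : 'M[R[i]]_n) :
  M \is unitarymx -> M \is a realmx -> \det M = 1 ->
  exists2 A, SO R n A & M = map_mx (real_complex R) A.
Proof.
move=> MU Mreal Mdet; pose A : 'M[R]_n := map_mx (@complex.Re R) M.
have MA : M = map_mx (real_complex R) A.
  apply/matrixP => i j; rewrite !mxE; symmetry; apply: RRe_real.
  by have /mxOverP := Mreal; apply.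
exists A => //; split.
  apply: (map_mx_inj (f := real_complex R)); rewrite map_mxM map_mx1 -map_trmx -MA.
  by have /unitarymxP := MU; rewrite -map_trmx realmxC.
by apply: (@complexI R); rewrite -det_map_mx -MA Mdet.
Qed.

Theorem proposition2p1 (R : realType) (G : set 'M[R[i]]_4)
    (G_sub : subgroup_of G (SU R 4))
    (G_fin : finite_set G)
    (G_age : forall g : 'M[R[i]]_4, G g -> age g <= 1) :
  exists2 U : 'M[R[i]]_4, U \is unitarymx &
    unitary_conj U G `<=` @SO3_in_SU4 R \/ unitary_conj U G `<=` @SU2_in_SU4 R.
Proof.
have [GSU G1 GM GV] := G_sub.
have [t Gt] := proj1 (finite_seqP _) G_fin.
pose s : seq 'M[R[i]]_(3 + 1) := undup t.
have Gs g : g \in s <-> G g by rewrite /s mem_undup Gt.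
have sG : finite_unitary_group s.
  split; rewrite ?undup_uniq //.
  - exact/Gs.
  - by move=> g h /Gs Gg /Gs Gh; apply/Gs/GM.
  - by move=> g /Gs/GSU[].
have sdet : {in s, forall g, \det g = 1} by move=> g /Gs/GSU[].
have str : {in s, forall g, 0 <= \tr g}.
  move=> g gs; have [r gr] := group_has_order sG gs.
  have := trace_ge_of_age gr (sdet g gs) (G_age g (proj1 (Gs g) gs)).
  rewrite subrr; apply; apply: G_age.
  by apply: GV; apply/Gs.
have [U UU split] := finite_unitary4_split sG sdet str.
exists U => //; case: split => split; [left|right] => _ [g /Gs/split[h]] + <-.
  move=> [hU hdet hreal Uh]; have [A SOA hA] := realmx_SO hU hreal hdet.
  by exists A => //; rewrite invmx_unitary // Uh hA.
move=> [hU hdet Uh]; exists h; first by split.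
by rewrite invmx_unitary // Uh.
Qed.
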